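(* Let $A$ be a Lebesgue measurable subset of $[0,1]$ that is 3-sum-free, i.e. there are no $x,y,z\in A$ (not necessarily distinct) with $x+y=3z$. Then $$\mu(A)\leq \frac{77}{177}.$$
   Context: $\mu$ denotes Lebesgue measure on $\mathbb{R}$. *)

(* Defs.v *)
From HB Require Import structures.
From mathcomp Require Import all_boot all_order all_algebra.
From mathcomp Require Import all_classical all_reals all_analysis.
Set Implicit Arguments. Unset Strict Implicit. Unset Printing Implicit Defensive.
Import Order.TTheory GRing.Theory Num.Theory.
Local Open Scope classical_set_scope.
Local Open Scope ring_scope.

Definition three_sum_free {R : realType} (A : set R) : Prop :=
  forall x y z, A x -> A y -> A z -> x + y != 3 * z.

(* Lebesgue measurable sets: the measurable sets of the domain of the completed
   Lebesgue measure, i.e. the Caratheodory sigma-algebra of Lebesgue outer measure. *)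
Definition lebesgue_measurable {R : realType} (A : set R) : Prop :=
  measurable (A : set (caratheodory_type (@wlength R idfun)^*%mu)).

(* Main.v *)
Require Import Defs.
From HB Require Import structures.
From mathcomp Require Import all_boot all_order all_algebra.
From mathcomp Require Import zify ring lra.
Import Order.TTheory GRing.Theory Num.Theory.
Local Open Scope ring_scope.

(* By inner regularity, let [A] be compact with least element [a] > 0, and let
   [F x] be the measure of the part of [A] up to [x]. For [s] in [A] let [u] be
   the least element of [A] in [2s/3, s], [T] the part of [A] in [u, s], and [d]
   the measure of the part of [u, s] outside [A]. For [x] in [A] the set [3A - x]
   misses [T], so that the window [(u+x)/3, (s+x)/3] contains at most [d/3] of
   [A]; and [3A] misses [T + T], which is large by Raikov's inequality on the
   circle of length [s - u], so that [2u/3, 2s/3], twice as long as a window,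
   also contains at most [d/3] of [A] when [T] fills half of [u, s].
   If two windows suffice for the part of [A] between [2s/9 + a/3] and [2u/3],
   then F(s) <= s/3 + F(2s/9 + a/3). Applied at three consecutive scales, this is
   sharp for the three intervals (8,12), (28,42), (118,177) scaled by 1/177.
   When it fails, then either [u - 2s/3] is large or [T] is sparse, and an [s]
   which nearly maximizes [F s / s] gives a contradiction, since the parts of [A]
   below [s/3] and [2s/3] then have at most the same density. *)

(** * Sumsets in cyclic groups *)

(* Dyson transform: replacing [X] by [X :|: (Y + e)] and [Y] by [Y :&: (X - e)]
   keeps the sum of the cardinals and shrinks [Y], unless [X + Y - Y] is
   contained in [X]; then [X + g] leaves [X] by a whole translate of [Y]. *)
Lemma card_sumset_shift (G : finZmodType) (g : G) (S : {set G}) :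
  (forall Z : {set G}, Z != set0 -> {in Z, forall x, x + g \in Z} -> Z = setT) ->
  forall X Y : {set G}, X != set0 -> Y != set0 ->
  (forall x y, x \in X -> y \in Y -> (x + y \in S) && (x + y + g \in S)) ->
  (minn #|G| (#|X| + #|Y|) <= #|S|)%N.
Proof.
move=> gen X Y; have [n] := ubnP #|Y|; elim: n X Y => // n IH X Y.
rewrite ltnS => Yn X0 Y0 XYS.
have [/existsP[x /existsP[y /existsP[y']]]|] :=
    boolP [exists x, exists y, exists y', [&& x \in X, y \in Y, y' \in Y &
      x - y + y' \notin X]].
  case/and4P=> xX yY y'Y nX; pose e := x - y.
  pose Ye := [set e + z | z in Y]; pose Y' := [set z in Y | e + z \in X].
  have yY' : y \in Y' by rewrite inE yY /e subrK.
  have Y'Y : (#|Y'| < #|Y|)%N.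
    apply: proper_card; apply/properP; split.
      by apply/subsetP => z; rewrite inE => /andP[].
    by exists y' => //; rewrite inE y'Y.
  have inte : X :&: Ye = [set e + z | z in Y'].
    apply/setP => z; rewrite inE; apply/andP/imsetP.
      by case=> zX /imsetP[w wY zE]; exists w => //; rewrite inE wY -zE.
    case=> w; rewrite inE => /andP[wY ewX] ->; split=> //.
    by apply/imsetP; exists w.
  have cardE : (#|X :|: Ye| + #|Y'| = #|X| + #|Y|)%N.
    have := cardsUI X Ye; rewrite inte !card_imset //; exact: addrI.
  rewrite -cardE; apply: IH.
  - exact: leq_trans Y'Y Yn.
  - by apply/set0Pn; exists x; rewrite inE xX.
  - by apply/set0Pn; exists y.
  - move=> u v; rewrite !inE => uXY /andP[vY evX].
    case/orP: uXY => [uX|/imsetP[w wY ->]]; first exact: XYS.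
    by rewrite addrAC; exact: XYS.
rewrite negb_exists => /forallP nex.
have XY x y y' : x \in X -> y \in Y -> y' \in Y -> x - y + y' \in X.
  move=> xX yY y'Y; move: (nex x); rewrite negb_exists => /forallP/(_ y).
  rewrite negb_exists => /forallP/(_ y').
  by rewrite xX yY y'Y /= negbK.
case/set0Pn: (Y0) => y0 y0Y.
have Xy : [set x + y0 | x in X] \subset S.
  by apply/subsetP => _ /imsetP[x xX ->]; case/andP: (XYS _ _ xX y0Y).
have cXy : #|[set x + y0 | x in X]| = #|X| by rewrite card_imset //; exact: addIr.
have [XT|XnT] := eqVneq X setT.
  apply: leq_trans (subset_leq_card Xy); rewrite cXy XT cardsT.
  exact: geq_minl.
have [x0 x0X x0g] : exists2 x0, x0 \in X & x0 + g \notin X.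
  apply/exists_inP; apply: contraNT XnT; rewrite negb_exists_in.
  by move=> /forall_inP h; apply/eqP/gen => // x /h; rewrite negbK.
apply: leq_trans (geq_minr _ _) _.
have sub2 : [set x + y0 | x in X] :|: [set x0 + y + g | y in Y] \subset S.
  rewrite subUset Xy; apply/subsetP => _ /imsetP[y yY ->].
  by case/andP: (XYS _ _ x0X yY).
apply: leq_trans (subset_leq_card sub2).
rewrite cardsU cXy card_imset; last by move=> u v /addIr/addrI.
rewrite (_ : _ :&: _ = set0) ?cards0 ?subn0 //.
apply/setP => z; rewrite !inE; apply/negP => /andP[/imsetP[x xX ->] /imsetP[y yY]].
move=> xE; have x0gE : x0 + g = x - y + y0.
  by rewrite [RHS]addrAC xE [in RHS]addrAC addrK.
by move: x0g; rewrite x0gE XY.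
Qed.

(** Adding 1 generates the cyclic group, so 1 can serve as [g] in [card_sumset_shift]. *)
Lemma ord_shift_setT n (Z : {set 'I_n.+1}) : Z != set0 ->
  {in Z, forall x, x + inZp 1 \in Z} -> Z = setT.
Proof.
case/set0Pn => z zZ Zg; apply/setP => y; rewrite inE.
have h k : z + inZp k \in Z.
  elim: k => [|k IH].
    by rewrite (_ : inZp 0 = 0) ?addr0 //; apply/val_inj; rewrite /= mod0n.
  rewrite (_ : inZp k.+1 = inZp k + inZp 1) ?addrA ?Zg //.
  by apply/val_inj; rewrite /= modnDm addn1.
by have := h (y - z); rewrite valZpK addrC subrK.
Qed.

(** A sum of points of the cells [k] and [l] lies in the cell [k + l] or [k + l + 1], hence the two
    shifts. With the complement of [J] as [S], a nonempty [J] excludes the value [#|G|] of the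
    minimum. *)
Lemma cyclic_sumset_card n (K J : {set 'I_n.+1}) : K != set0 -> J != set0 ->
  (forall i k l j, (i < 2)%N -> k \in K -> l \in K -> j \in J ->
     (k + l + i != j %[mod n.+1])%N) ->
  (#|K| + #|K| + #|J| <= n.+1)%N.
Proof.
move=> K0 J0 KJ.
have KS x y : x \in K -> y \in K -> (x + y \in ~: J) && (x + y + inZp 1 \in ~: J).
  move=> xK yK; rewrite !inE; apply/andP; split; apply/negP => jJ.
    by have /eqP := KJ 0%N x y _ isT xK yK jJ; rewrite /= addn0 modn_mod.
  by have /eqP := KJ 1%N x y _ isT xK yK jJ; rewrite /= modnDm modn_mod.
have := card_sumset_shift _ _ _ (@ord_shift_setT n) _ _ K0 K0 KS.
have JC : (#|J| + #|~: J| = n.+1)%N by rewrite cardsC card_ord.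
have J1 : (0 < #|J|)%N by rewrite card_gt0.
rewrite card_ord geq_min.
move: #|J| #|K| #|~: J| JC J1 => cJ cK cJ' <- J1; lia.
Qed.

Lemma modn_eq_or_addn m j N : (m < 2 * N)%N -> (j < N)%N ->
  m = j %[mod N] -> m = j \/ m = (j + N)%N.
Proof.
move=> mN jN; rewrite [in RHS]modn_small // => E.
have := divn_eq m N; rewrite E; have : (m %/ N < 2)%N by rewrite ltn_divLR; lia.
by case: (m %/ N)%N => [|[|//]] _ ->; [left|right]; lia.
Qed.

From mathcomp Require Import all_classical all_reals all_analysis measurable_realfun.
Import numFieldNormedType.Exports.
Local Open Scope classical_set_scope.
Local Open Scope ring_scope.

(** * Measures of sets avoiding sums *)

Section Measure.
Context (R : realType).
Implicit Types (S A E : set R) (x y u v k b : R).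
Local Notation mu := (@lebesgue_measure R).

Lemma continuous_affine k b : continuous (fun y : R => k * y + b).
Proof.
move=> y; apply: cvgD; last exact: cvg_cst.
by apply: cvgM; [exact: cvg_cst|exact: cvg_id].
Qed.

Lemma measurable_affine k b E : measurable E -> measurable [set y | E (k * y + b)].
Proof.
move=> mE; rewrite -[X in measurable X]setTI.
have mf : measurable_fun [set: R] (fun y : R => k * y + b).
  exact: continuous_measurable_fun (continuous_affine k b).
exact: (mf measurableT E mE).
Qed.

(** [k] times the image of [mu] under the affine map agrees with [mu] on half-open intervals, which
    determine it. *)
Lemma lebesgue_measure_affine k b E : 0 < k -> measurable E ->
  mu E = (k%:E * mu [set y | E (k * y + b)%R])%E.
Proof.
move=> k0 mE.
pose f (y : measurableTypeR R) : measurableTypeR R := k * y + b.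
have mf : measurable_fun [set: measurableTypeR R] f.
  exact: continuous_measurable_fun (continuous_affine k b).
pose m : {measure set (measurableTypeR R) -> \bar R} :=
  measure_function_pushforward__canonical__measure_function_Measure mu mf.
pose nu : {measure set (measurableTypeR R) -> \bar R} := mscale (NngNum (ltW k0)) m.
transitivity (nu E); last by [].
apply: lebesgue_measure_unique => //= _ [[c d]] _ <-.
rewrite /nu /mscale /m /pushforward /f /=.
rewrite [X in (_ * lebesgue_measure X)%E](_ : _ =
    `](c - b) / k, (d - b) / k]%classic); last first.
  apply/seteqP; split => z /=; rewrite !in_itv /= ltr_pdivrMr // ler_pdivlMr //;
  by rewrite ltrBlDr lerBrDr mulrC.
rewrite !lebesgue_measure_itv /= !lte_fin ltr_pM2r ?invr_gt0 // ltrD2r.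
case: ifP => _; last by rewrite mule0.
by rewrite -!EFinD -EFinM; congr (_%:E); field; exact: lt0r_neq0.
Qed.

(** * Distribution functions *)

Definition cdf S x : R := fine (mu (S `&` `]-oo, x])).

Section Cdf.
Variables (S : set R).
Hypotheses (mS : measurable S) (Sfin : (mu S < +oo)%E).
Let F := cdf S.

Let fin E : measurable E -> mu (S `&` E) \is a fin_num.
Proof.
move=> mE; rewrite ge0_fin_numE // (le_lt_trans _ Sfin) // le_measure ?inE //.
exact: measurableI.
Qed.

Lemma cdfE x : mu (S `&` `]-oo, x]) = (F x)%:E.
Proof. by rewrite fineK // fin. Qed.

Lemma cdf_seg u v : u <= v -> mu (S `&` `]u, v]) = (F v - F u)%:E.
Proof.
move=> uv; have -> : (F v - F u)%:E = (mu (S `&` `]-oo, v]) - mu (S `&` `]-oo, u]))%E.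
  by rewrite !cdfE EFinB.
have -> : S `&` `]-oo, v] = (S `&` `]-oo, u]) `|` (S `&` `]u, v]).
  rewrite -setIUr; congr (_ `&` _); apply/seteqP; split => z /=; rewrite !in_itv /=.
    by move=> zv; have [zu|zu] := leP z u; [left|right].
  by case=> [/le_trans->//|/andP[]].
have dis : (S `&` `]-oo, u]) `&` (S `&` `]u, v]) = set0.
  apply/seteqP; split => // z /= -[[_ zu] [_ zv]].
  by move: zu zv; rewrite !in_itv /= => zu /andP[/(le_lt_trans zu)]; rewrite ltxx.
have -> : mu ((S `&` `]-oo, u]) `|` (S `&` `]u, v])) =
    (mu (S `&` `]-oo, u]) + mu (S `&` `]u, v]))%E.
  by apply: measureU => //; exact: measurableI.
by rewrite cdfE addeAC subee // add0e.
Qed.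

Lemma cdf_mono u v : u <= v -> F u <= F v.
Proof. by move=> uv; rewrite -subr_ge0 -lee_fin -cdf_seg. Qed.

Lemma cdf_lip u v : u <= v -> F v - F u <= v - u.
Proof.
move=> uv; rewrite -lee_fin -cdf_seg // (@le_trans _ _ (mu `]u, v])) //.
  by rewrite le_measure ?inE //; exact: measurableI.
by rewrite lebesgue_measure_itv /= lte_fin; case: ltP => // vu; rewrite lee_fin subr_ge0.
Qed.

Lemma cdf_eq u v : u <= v -> (forall x, u < x -> x <= v -> ~ S x) -> F u = F v.
Proof.
move=> uv nS; apply/eqP; rewrite eq_sym -subr_eq0 -eqe -cdf_seg //.
rewrite (_ : _ `&` _ = set0) ?measure0 //.
by apply/seteqP; split => // z [Sz] /=; rewrite in_itv /= => /andP[uz zv]; exact: nS Sz.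
Qed.

Lemma cdf_eq_lt u v : u <= v -> (forall x, u < x -> x < v -> ~ S x) -> F u = F v.
Proof.
move=> uv nS; apply/eqP; rewrite eq_sym -subr_eq0 -eqe -cdf_seg //.
rewrite eq_le measure_ge0 andbT -[X in (_ <= X)%E](lebesgue_measure_set1 v).
rewrite le_measure ?inE //; first exact: measurableI.
move=> z [Sz] /=; rewrite in_itv /= => /andP[uz]; rewrite le_eqVlt => /predU1P[//|zv].
by case: (nS _ uz zv).
Qed.

(** For [k = 3^-1], [b = x / 3] this is a piece of [3 S - x]; for [k = - 1], [b = 3 x] a piece of
    [3 x - S]. *)
Definition seg_preim k b u v := [set y | (S `&` `]u, v]) (k * y + b)].

Lemma measurable_seg_preim k b u v : measurable (seg_preim k b u v).
Proof. by apply: measurable_affine; exact: measurableI. Qed.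

Lemma seg_preim_measure k b u v : 0 < k -> u <= v ->
  mu (seg_preim k b u v) = (k^-1 * (F v - F u))%:E.
Proof.
move=> k0 uv; have mSI : measurable (S `&` `]u, v]) by exact: measurableI.
rewrite EFinM -cdf_seg // (lebesgue_measure_affine k b _ k0 mSI).
by rewrite muleA -EFinM mulVf ?mul1e // lt0r_neq0.
Qed.

Lemma seg_preim_measureN b u v : u <= v ->
  mu (seg_preim (- 1) b u v) = (F v - F u)%:E.
Proof.
move=> uv; have := lebesgue_measureN (measurable_seg_preim 1 b u v).
rewrite seg_preim_measure // invr1 mul1r => <-.
by rewrite /pushforward /seg_preim; congr (mu _); apply/seteqP; split => y /=;
  rewrite mul1r mulN1r.
Qed.
End Cdf.

Lemma measure_pack3 E1 E2 E3 U : measurable E1 -> measurable E2 -> measurable E3 ->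
  measurable U -> E1 `<=` U -> E2 `<=` U -> E3 `<=` U ->
  (forall z, E1 z -> ~ E2 z) -> (forall z, E1 z -> ~ E3 z) ->
  (forall z, E2 z -> ~ E3 z) ->
  (mu E1 + mu E2 + mu E3 <= mu U)%E.
Proof.
move=> m1 m2 m3 mU s1 s2 s3 d1 d2 d3.
have d12 : E1 `&` E2 = set0 by apply/seteqP; split => // z [/d1].
have d123 : (E1 `|` E2) `&` E3 = set0.
  by apply/seteqP; split => // z [[/d2|/d3]].
have m12 : measurable (E1 `|` E2) by exact: measurableU.
have e1 : mu (E1 `|` E2) = (mu E1 + mu E2)%E by exact: measureU.
have e2 : mu (E1 `|` E2 `|` E3) = (mu (E1 `|` E2) + mu E3)%E by exact: measureU.
rewrite -e1 -e2 le_measure ?inE //; first exact: measurableU.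
by move=> z [[/s1|/s2]|/s3].
Qed.

(** * Raikov's inequality by discretization *)

Lemma compact_sum_gap S T c : compact S -> compact T ->
  (forall e x y, S e -> T x -> T y -> x + y != e + c) ->
  exists2 d, 0 < d & forall e x y, S e -> T x -> T y -> d <= `|x + y - (e + c)|.
Proof.
move=> cS cT ne.
have [[[[e0 x0] y0] [[/= Se0 Tx0] Ty0]]|nex] :=
    pselect (exists p : R * R * R, (S `*` T `*` T) p); last first.
  by exists 1 => // e x y Se Tx Ty; case: nex; exists (e, x, y).
pose g (p : R * R * R) := `|p.1.2 + p.2 - (p.1.1 + c)|.
have cg : continuous g.
  move=> p; apply: cvg_norm; apply: cvgB; apply: cvgD; last exact: cvg_cst.
  - by apply: (cvg_comp (@fst (R * R)%type R) snd); [exact: cvg_fst|exact: cvg_snd].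
  - exact: cvg_snd.
  - by apply: (cvg_comp (@fst (R * R)%type R) fst); [exact: cvg_fst|exact: cvg_fst].
have cSTT : compact (S `*` T `*` T) by do 2 apply: compact_setX => //.
have [|[[e x] y]] := compact_EVT_min _ cSTT (continuous_subspaceT cg).
  by exists (e0, x0, y0).
rewrite inE => -[[/= Se Tx] Ty] gmin; exists (g (e, x, y)).
  by rewrite normr_gt0 subr_eq0 ne.
by move=> e' x' y' Se' Tx' Ty'; apply: (gmin (e', x', y')); rewrite inE.
Qed.

Definition meets S h (k : nat) := `[< exists2 x, S x & k%:R * h <= x <= k.+1%:R * h >].

Lemma cdf_le_cells S h n : measurable S -> (mu S < +oo)%E -> 0 <= h ->
  (forall x, S x -> 0 <= x) ->
  cdf S (n%:R * h) <= \sum_(k < n | meets S h k) h.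
Proof.
move=> mS Sfin h0 S0; elim: n => [|n IH].
  rewrite mul0r big_ord0 -lee_fin -cdfE //.
  apply: (@le_trans _ _ (mu [set (0 : R)])); last by rewrite lebesgue_measure_set1.
  rewrite le_measure ?inE //; first exact: measurableI.
  move=> z [/S0 z0] /=; rewrite in_itv /= => zle.
  by apply/eqP; rewrite eq_le z0 zle.
rewrite big_mkcond big_ord_recr -big_mkcond /=.
have nh : n%:R * h <= n.+1%:R * h by rewrite ler_wpM2r // ler_nat.
have [mt|nm] := boolP (meets S h n).
  have := cdf_lip S mS Sfin _ _ nh; rewrite -mulrBl -natrB // subSnn mul1r => lip.
  by rewrite -(subrK (cdf S (n%:R * h)) (cdf S (n.+1%:R * h))) addrC lerD.
rewrite addr0 -(cdf_eq S mS Sfin _ _ nh) // => x xl xu Sx.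
by move/asboolP: nm; apply; exists x => //; rewrite (ltW xl).
Qed.

(* Raikov's inequality on the circle of length [D], for [S] disjoint from [T + T]
   modulo [D]: at a mesh finer than the gap between the two, the cells meeting
   [S] avoid the sums (and their successors) of the cells meeting [T]. *)
Lemma cyclic_measure S T D : 0 < D -> compact S -> compact T ->
  (forall x, S x -> 0 <= x <= D) -> (forall x, T x -> 0 <= x <= D) ->
  (forall e x y, S e -> T x -> T y -> x + y != e) ->
  (forall e x y, S e -> T x -> T y -> x + y != e + D) ->
  (0 < mu S)%E -> (mu S + mu T + mu T <= D%:E)%E.
Proof.
move=> D0 cS cT S0 T0 ne1 ne2 Spos.
have mS := compact_measurable cS.
have mT := compact_measurable cT.
have fS := compact_finite_measure cS; have fT := compact_finite_measure cT.
have [|d1 d10 gap1] := compact_sum_gap S T 0 cS cT.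
  by move=> e x y; rewrite addr0; exact: ne1.
have [d2 d20 gap2] := compact_sum_gap S T D cS cT ne2.
(* For points in the cells [k], [l], [j] with [k + l + i = j], [i < 2], the sum of the first two
   differs from the third by at most [2 h]; the mesh makes this less than both gaps. *)
have [n nbig] : exists n : nat, 2 * D < n.+1%:R * Num.min d1 d2.
  have m0 : 0 < Num.min d1 d2 by rewrite lt_min d10.
  exists (Num.bound (2 * D / Num.min d1 d2)).
  rewrite -ltr_pdivrMr // (lt_le_trans (archi_boundP _)) ?ler_nat //.
  by rewrite divr_ge0 ?ltW // mulr_gt0.
pose h := D / n.+1%:R.
have hN : n.+1%:R * h = D by rewrite /h mulrC divfK.
have h0 : 0 < h by rewrite divr_gt0.
have [hd1 hd2] : 2 * h < d1 /\ 2 * h < d2.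
  suff : 2 * h < Num.min d1 d2 by rewrite lt_min => /andP[].
  by rewrite /h mulrA ltr_pdivrMr // [X in _ < X]mulrC.
pose K : {set 'I_n.+1} := finset (fun k : 'I_n.+1 => meets T h k).
pose J : {set 'I_n.+1} := finset (fun k : 'I_n.+1 => meets S h k).
have total X : measurable X -> (mu X < +oo)%E -> (forall x, X x -> 0 <= x <= D) ->
    (mu X <= (h *+ #|finset (fun k : 'I_n.+1 => meets X h k)|)%:E)%E.
  move=> mX fX X0; have -> : mu X = (cdf X (n.+1%:R * h))%:E.
    rewrite -cdfE // hN; congr (mu _); apply/seteqP; split => [z Xz|z []//].
    by split => //=; rewrite in_itv /=; case/andP: (X0 z Xz).
  rewrite lee_fin; apply: le_trans (cdf_le_cells X h n.+1 mX fX (ltW h0) _) _.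
    by move=> x /X0/andP[].
  by rewrite -sumr_const; rewrite le_eqVlt; apply/orP; left; apply/eqP;
    apply: eq_bigl => k; rewrite inE.
have tS := total S mS fS S0; have tT := total T mT fT T0.
have J0 : J != finset.set0.
  apply/eqP => J0; move: (lt_le_trans Spos tS).
  by rewrite -/J J0 cards0 mulr0n ltxx.
suff KJ : (#|K| + #|K| + #|J| <= n.+1)%N.
  apply: le_trans (leeD (leeD tS tT) tT) _; rewrite -!EFinD lee_fin -!mulrnDr.
  by rewrite -hN -[h *+ _]mulr_natl ler_wpM2r ?(ltW h0) // ler_nat -addnA addnC.
have [->|K0] := eqVneq K finset.set0.
  by rewrite cards0 !add0n -[X in (_ <= X)%N](card_ord n.+1) max_card.
apply: cyclic_sumset_card => // i k l j i2.
rewrite !inE => -[x Tx /andP[x1 x2]] [y Ty /andP[y1 y2]] [e Se /andP[e1 e2]].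
apply/negP => /eqP E.
have [ih0 ih1] : 0 <= i%:R * h /\ i%:R * h <= h.
  split; first by rewrite mulr_ge0 // ltW.
  by apply: ler_piMl; [exact: ltW|rewrite (ler_nat _ i 1)].
have klN : (k + l + i < 2 * n.+1)%N.
  by clear -i2; have := ltn_ord k; have := ltn_ord l; lia.
have [eq|eq] := modn_eq_or_addn _ _ _ klN (ltn_ord j) E.
- have := gap1 e x y Se Tx Ty; rewrite addr0 leNgt => /negP; apply.
  apply: le_lt_trans hd1; rewrite ler_norml.
  have kj : k%:R + l%:R + i%:R = j%:R :> R by rewrite -!natrD eq.
  move: x1 x2 y1 y2 e1 e2; rewrite -!natr1 !mulrDl -kj !mulrDl !mul1r => x1 x2 y1 y2 e1 e2.
  by apply/andP; split; lra.
- have := gap2 e x y Se Tx Ty; rewrite leNgt => /negP; apply.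
  apply: le_lt_trans hd2; rewrite ler_norml.
  have kj : j%:R = k%:R + l%:R + i%:R - n.+1%:R :> R by rewrite -!natrD eq natrD addrK.
  move: x1 x2 y1 y2 e1 e2; rewrite kj -![(_ : 'I_n.+1).+1%:R]natr1 kj !mulrDl !mulNr hN !mul1r.
  by move=> x1 x2 y1 y2 e1 e2; apply/andP; split; lra.
Qed.

(** * Inequalities for compact three-sum-free sets *)

Section Fields.
Variables (A : set R).
Hypotheses (cA : compact A) (sA : three_sum_free A).
Let F := cdf A.
Let mA : measurable A. Proof. exact: compact_measurable. Qed.
Let Afin : (mu A < +oo)%E. Proof. exact: compact_finite_measure. Qed.
Let clA : closed A. Proof. by apply: compact_closed => //; exact: Rhausdorff. Qed.

Let sf x y z : A x -> A y -> A z -> x + y = 3 * z -> False.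
Proof. by move=> Ax Ay Az /eqP; apply/negP; exact: sA. Qed.

Lemma cdf_min u v : u <= v ->
  (exists x, [/\ A x, u <= x, x <= v & F x = F u]) \/ F u = F v.
Proof.
move=> uv; have cuv : compact (A `&` `[u, v]).
  by apply: compact_closedI => //; exact: itv_closed.
have [[x0 Ax0]|nA] := pselect (exists x, (A `&` `[u, v]) x); last first.
  right; apply: cdf_eq => // x ux xv Ax; apply: nA; exists x; split => //=.
  by rewrite in_itv /= xv ltW.
have idc : {within A `&` `[u, v], continuous (@idfun R)}.
  by apply: continuous_subspaceT => x; exact: cvg_id.
have [x] := compact_EVT_min (ex_intro _ x0 Ax0) cuv idc.
rewrite inE => -[Ax /=]; rewrite in_itv /= => /andP[ux xv] xmin.
left; exists x; split => //; apply/esym/cdf_eq_lt => // y uy yx Ay.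
have : x <= y.
  apply: xmin; rewrite inE; split => //=.
  by rewrite in_itv /= (ltW uy) ltW // (lt_le_trans yx).
by rewrite leNgt yx.
Qed.

Lemma cdf_max u v : u <= v ->
  (exists x, [/\ A x, u <= x, x <= v & F x = F v]) \/ F u = F v.
Proof.
move=> uv; have cuv : compact (A `&` `[u, v]).
  by apply: compact_closedI => //; exact: itv_closed.
have [[x0 Ax0]|nA] := pselect (exists x, (A `&` `[u, v]) x); last first.
  right; apply: cdf_eq => // x ux xv Ax; apply: nA; exists x; split => //=.
  by rewrite in_itv /= xv ltW.
have idc : {within A `&` `[u, v], continuous (@idfun R)}.
  by apply: continuous_subspaceT => x; exact: cvg_id.
have [x] := compact_EVT_max (ex_intro _ x0 Ax0) cuv idc.
rewrite inE => -[Ax /=]; rewrite in_itv /= => /andP[ux xv] xmax.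
left; exists x; split => //; apply: cdf_eq => // y xy yv Ay.
have : y <= x.
  apply: xmax; rewrite inE; split => //=.
  by rewrite in_itv /= yv ltW // (le_lt_trans ux).
by rewrite leNgt xy.
Qed.

(** The part of [3 A - x] in []u, s]] is the window blown up three times, and it misses [A]. *)
Lemma cdf_shift u s x : u <= s -> A x ->
  (F s - F u) + 3 * (F ((s + x) / 3) - F ((u + x) / 3)) <= s - u.
Proof.
move=> us Ax; have us3 : (u + x) / 3 <= (s + x) / 3 by lra.
have := measure_pack3 (A `&` `]u, s]) (seg_preim A 3^-1 (x / 3) ((u + x) / 3) ((s + x) / 3))
  set0 `]u, s].
rewrite measure0 adde0 cdf_seg // seg_preim_measure // ?invr_gt0 // invrK.
rewrite lebesgue_measure_itv /= lte_fin -EFinD.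
case: ltP => [_|su]; last first.
  by move=> _; rewrite (le_anti (introT andP (conj su us))) !subrr mulr0 addr0.
rewrite -EFinB lee_fin; apply => //.
- exact: measurableI.
- exact: measurable_seg_preim.
- by move=> z [_ /=]; rewrite !in_itv /= => /andP[? ?]; apply/andP; split; lra.
- by move=> z [Az _] [Az' _]; apply: (sf z x _ Az Ax Az'); field.
- by move=> ? _ [].
- by move=> ? _ [].
Qed.

(** [3 A - x] is used to the right of [2 x] and [3 x - A] to the left, so that they are disjoint
    from each other as well as from [A]. *)
Lemma cdf_reflect u s x : A x -> u <= 2 * x -> 2 * x <= s ->
  (F s - F u) + 3 * (F ((s + x) / 3) - F x) + (F (3 * x - u) - F x) <= s - u.
Proof.
move=> Ax ux xs; have xsx : x <= (s + x) / 3 by lra.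
have xxu : x <= 3 * x - u by lra.
have us : u <= s by lra.
have := measure_pack3 (A `&` `]u, s]) (seg_preim A 3^-1 (x / 3) x ((s + x) / 3))
  (seg_preim A (- 1) (3 * x) x (3 * x - u)) `[u, s].
rewrite cdf_seg // seg_preim_measure // ?invr_gt0 // invrK seg_preim_measureN //.
rewrite lebesgue_measure_itv /= lte_fin -!EFinD.
case: ltP => [_|su]; last first.
  have -> : (s + x) / 3 = x by lra.
  have -> : 3 * x - u = x by lra.
  by move=> _; rewrite (le_anti (introT andP (conj su us))) !subrr mulr0 !addr0.
rewrite lee_fin; apply => //.
- exact: measurableI.
- exact: measurable_seg_preim.
- exact: measurable_seg_preim.
- by move=> z [_ /=]; rewrite !in_itv /= => /andP[? ?]; apply/andP; split; lra.
- by move=> z [_ /=]; rewrite !in_itv /= => /andP[? ?]; apply/andP; split; lra.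
- by move=> z [_ /=]; rewrite !in_itv /= => /andP[? ?]; apply/andP; split; lra.
- by move=> z [Az _] [Az' _]; apply: (sf z x _ Az Ax Az'); field.
- by move=> z [Az _] [Az' _]; apply: (sf z _ x Az Az' Ax); ring.
- move=> z [_ /=] + [_ /=]; rewrite !in_itv /= => /andP[h1 h2] /andP[h3 h4]; lra.
Qed.

Lemma compact_affine_preim k b u v : compact [set y | A (k * y + b) /\ u <= y <= v].
Proof.
have -> : [set y | A (k * y + b) /\ u <= y <= v] = `[u, v] `&` [set y | A (k * y + b)].
  by apply/seteqP; split => y /=; rewrite in_itv /= => -[].
apply: compact_closedI; first exact: segment_compact.
by move/continuous_closedP: (continuous_affine k b); exact.
Qed.

(* Modulo [s - u], a residue of [T + T] cannot occur in both halves [E1] and [E2]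
   of [3 A `&` `[2 u, 2 s]], while a residue of [T] occurs in neither of them. *)
Lemma cdf_double u s : A u -> A s -> u <= s ->
  (s - u <= 2 * (F s - F u) ->
     3 * (F (2 * s / 3) - F (2 * u / 3)) <= (s - u) - (F s - F u)) /\
  (2 * (F s - F u) <= s - u ->
     3 * (F (2 * s / 3) - F (2 * u / 3)) <= 2 * (s - u) - 3 * (F s - F u)).
Proof.
move=> Au As us; pose D := s - u.
have [Dpos|D0] := ltP 0 D; last first.
  have su : s <= u by rewrite -subr_le0.
  by rewrite (le_anti (introT andP (conj us su))) !subrr !mulr0 subrr.
pose E1 := seg_preim A 3^-1 (2 * u / 3) (2 * u / 3) ((u + s) / 3).
pose E2 := seg_preim A 3^-1 ((u + s) / 3) ((u + s) / 3) (2 * s / 3).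
pose T := seg_preim A 1 u u s.
have mE1 : measurable E1 by exact: measurable_seg_preim.
have mE2 : measurable E2 by exact: measurable_seg_preim.
have mT : measurable T by exact: measurable_seg_preim.
have le1 : 2 * u / 3 <= (u + s) / 3 by lra.
have le2 : (u + s) / 3 <= 2 * s / 3 by lra.
have muE1 : mu E1 = (3 * (F ((u + s) / 3) - F (2 * u / 3)))%:E.
  by rewrite seg_preim_measure // ?invrK // invr_gt0.
have muE2 : mu E2 = (3 * (F (2 * s / 3) - F ((u + s) / 3)))%:E.
  by rewrite seg_preim_measure // ?invrK // invr_gt0.
have muT : mu T = (F s - F u)%:E by rewrite seg_preim_measure // invr1 mul1r.
have rng1 z : E1 z -> [/\ A (3^-1 * z + 2 * u / 3), 0 < z & z <= D].
  by rewrite /E1 /seg_preim /= in_itv /= /D => -[? /andP[? ?]]; split => //; lra.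
have rng2 z : E2 z -> [/\ A (3^-1 * z + (u + s) / 3), 0 < z & z <= D].
  by rewrite /E2 /seg_preim /= in_itv /= /D => -[? /andP[? ?]]; split => //; lra.
have rngT z : T z -> [/\ A (1 * z + u), 0 < z & z <= D].
  by rewrite /T /seg_preim /= in_itv /= /D => -[? /andP[? ?]]; split => //; lra.
have mU : measurable (E1 `|` E2) by exact: measurableU.
have mI : measurable (E1 `&` E2) by exact: measurableI.
have muD : mu `]0, D] = D%:E.
  by rewrite lebesgue_measure_itv /= lte_fin Dpos -EFinB subr0.
have mUT : (mu (E1 `|` E2) + mu T <= D%:E)%E.
  have := measure_pack3 (E1 `|` E2) T set0 `]0, D] mU mT.
  rewrite measure0 adde0 muD; apply => //.
  - by move=> z [/rng1|/rng2] [_ ? ?] /=; rewrite in_itv /=; apply/andP.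
  - by move=> z /rngT[_ ? ?] /=; rewrite in_itv /=; apply/andP.
  (* For [z] in [E1] the point of [3 A] is [(z + u) + u], for [z] in [E2] it is [(z + u) + s]. *)
  - move=> z [/rng1|/rng2] [Az _ _] /rngT[Az' _ _].
      by apply: (sf _ _ _ Az' Au Az); field.
    by apply: (sf _ _ _ Az' As Az); field.
  - by move=> ? _ [].
  - by move=> ? _ [].
have Ifin : mu (E1 `&` E2) \is a fin_num.
  rewrite ge0_fin_numE //; apply: (@le_lt_trans _ _ (mu E1)).
    by rewrite le_measure ?inE.
  by rewrite muE1 ltry.
have mDI : (mu E1 + mu E2 = mu (E1 `|` E2) + mu (E1 `&` E2))%E.
  have -> : mu (E1 `|` E2) = (mu E1 + mu E2 - mu (E1 `&` E2))%E.
    have E1fin : (mu E1 < +oo)%E by rewrite muE1 ltry.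
    exact: measureUfinl.
  by rewrite subeK.
have mI0 : (mu (E1 `&` E2) <= 0 \/ mu (E1 `&` E2) + mu T + mu T <= D%:E)%E.
  have [|Ipos] := leP (mu (E1 `&` E2)) 0%E; first by left.
  right; pose cI := [set y | A (3^-1 * y + 2 * u / 3) /\ 0 <= y <= D] `&`
                    [set y | A (3^-1 * y + (u + s) / 3) /\ 0 <= y <= D].
  pose cT := [set y | A (1 * y + u) /\ 0 <= y <= D].
  have kI : compact cI.
    apply: compact_closedI; first exact: compact_affine_preim.
    by apply: compact_closed; [exact: Rhausdorff|exact: compact_affine_preim].
  have kT : compact cT by exact: compact_affine_preim.
  have leI : (mu (E1 `&` E2) <= mu cI)%E.
    rewrite le_measure ?inE //; first exact: compact_measurable.
    move=> z [/rng1[A1 z0 zD] /rng2[A2 _ _]].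
    by split; split => //; rewrite (ltW z0).
  have leT : (mu T <= mu cT)%E.
    rewrite le_measure ?inE //; first exact: compact_measurable.
    by move=> z /rngT[A1 z0 zD]; split => //; rewrite (ltW z0).
  apply: le_trans (leeD (leeD leI leT) leT) _.
  apply: cyclic_measure => //; last exact: lt_le_trans Ipos leI.
  - by move=> z [[]].
  - by move=> z [].
  - move=> e x y [[Ae _] _] [Ax _] [Ay _]; apply/eqP => exy.
    by apply: (sf _ _ _ Ax Ay Ae); rewrite -exy; field.
  - move=> e x y [_ [Ae _]] [Ax _] [Ay _]; apply/eqP => exy.
    apply: (sf _ _ _ Ax Ay Ae); have -> : e = x + y - D by rewrite exy addrK.
    by rewrite /D; field.
have Ufin : mu (E1 `|` E2) \is a fin_num.
  rewrite ge0_fin_numE //; apply: (@le_lt_trans _ _ (mu (E1 `|` E2) + mu T)%E).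
    by rewrite leeDl.
  by apply: le_lt_trans mUT _; rewrite ltry.
move: mDI mUT mI0; rewrite muE1 muE2 muT -(fineK Ifin) -(fineK Ufin) -!EFinD !lee_fin.
case=> h1 h2 h3.
have Fus := cdf_mono A mA Afin _ _ us.
rewrite -/D /F in Fus h1 h2 h3 *.
(* The two halves measure together at most [D - mu T] for their union plus the larger of 0 and
   [D - 2 mu T] for their intersection. *)
by split=> h; case: h3 => h3; lra.
Qed.
End Fields.
End Measure.

(** * Distribution functions of three-sum-free sets *)

(* The facts about [F x := mu (A `&` `]-oo, x])] which imply the bound:
   [prof_shift] says that [3 A - x] misses [A], [prof_reflect] that both
   [3 A - x] and [3 x - A] do, and [prof_double] that [3 A] misses [T + T] for
   [T := A `&` `[u, s]]; its two cases are [mu (T + T)] at least [s - u + mu T],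
   respectively at least [3 mu T]. *)
Record profile (R : realType) (A : set R) (a : R) (F : R -> R) : Prop := Profile {
  prof_gt0 : 0 < a;
  prof_mem : A a;
  prof_lb : forall x, A x -> a <= x;
  prof0 : forall x, x <= a -> F x = 0;
  prof_mono : forall x y, x <= y -> F x <= F y;
  prof_lip : forall x y, x <= y -> F y - F x <= y - x;
  prof_min : forall u v, u <= v ->
    (exists x, [/\ A x, u <= x, x <= v & F x = F u]) \/ F u = F v;
  prof_max : forall u v, u <= v ->
    (exists x, [/\ A x, u <= x, x <= v & F x = F v]) \/ F u = F v;
  prof_shift : forall u s x, u <= s -> A x ->
    (F s - F u) + 3 * (F ((s + x) / 3) - F ((u + x) / 3)) <= s - u;
  prof_reflect : forall u s x, A x -> u <= 2 * x -> 2 * x <= s ->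
    (F s - F u) + 3 * (F ((s + x) / 3) - F x) + (F (3 * x - u) - F x) <= s - u;
  prof_double : forall u s, A u -> A s -> u <= s ->
    (s - u <= 2 * (F s - F u) ->
       3 * (F (2 * s / 3) - F (2 * u / 3)) <= (s - u) - (F s - F u)) /\
    (2 * (F s - F u) <= s - u ->
       3 * (F (2 * s / 3) - F (2 * u / 3)) <= 2 * (s - u) - 3 * (F s - F u)) }.

(** * The density bound for profiles *)

Section Arith.
Context (R : realType) (A : set R) (a : R) (F : R -> R) (P : profile R A a F).
Let mono := prof_mono R A a F P.
Let lip := prof_lip R A a F P.
Let F0 := prof0 R A a F P.
Let a0 := prof_gt0 R A a F P.
Let Aa := prof_mem R A a F P.
Let lb := prof_lb R A a F P.
Let minP := prof_min R A a F P.
Let maxP := prof_max R A a F P.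
Let reflect := prof_reflect R A a F P.
Let double := prof_double R A a F P.

Lemma prof_le x : a <= x -> F x <= x - a.
Proof. by move=> /lip; rewrite (F0 a (lexx _)) subr0. Qed.

(** This split lets linear arithmetic treat overlapping and separated windows alike. *)
Lemma prof_lipP x y :
  (y <= x /\ F y <= F x) \/ [/\ x <= y, F x <= F y & F y - F x <= y - x].
Proof.
have [h|/ltW h] := leP x y; [right|left]; split; rewrite ?mono ?lip //.
Qed.

Lemma prof_top s : A s ->
  exists u, [/\ A u, 2 * s / 3 <= u, u <= s & F u = F (2 * s / 3)].
Proof.
move=> As; have as_ := lb s As.
have h : 2 * s / 3 <= s by move: a0; lra.
have [[u [Au su us Fu]]|Fe] := minP _ _ h; first by exists u.
by exists s.
Qed.

Lemma prof_window u s x : u <= s -> A x -> forall y z,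
  y = (u + x) / 3 -> z = (s + x) / 3 ->
  (F s - F u) + 3 * (F z - F y) <= s - u.
Proof. by move=> us Ax y z -> ->; exact: (prof_shift R A a F P). Qed.

(* The windows of [a], [u] and [s] cover almost all of [A] below [u]. *)
Lemma prof_third y : 0 <= y -> y <= 3 * a -> F y <= y / 3.
Proof.
move=> y0 ya; have [yla|/ltW ay] := leP y a; first by rewrite F0 //; lra.
have [[s [As as_ sy <-]]|<-] := maxP a y ay; last first.
  by rewrite F0 //; lra.
suff : F s <= s / 3 by lra.
have [h|h] := leP (2 * s / 3) a; first by have := prof_le s as_; lra.
have [u [Au su us Fu]] := prof_top s As.
have w1 := prof_window u s a us Aa _ _ erefl erefl.
have w2 := prof_window u s u us Au (2 * u / 3) ((s + u) / 3) ltac:(lra) erefl.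
have w3 := prof_window u s s us As ((s + u) / 3) (2 * s / 3) ltac:(lra) ltac:(lra).
have h1 := prof_lipP a ((u + a) / 3); have Fa := F0 a (lexx _).
have h2 := prof_lipP ((s + a) / 3) (2 * u / 3).
case: h1 => [[? ?]|[? ? ?]]; case: h2 => [[? ?]|[? ? ?]]; lra.
Qed.

(* The windows left of [(s + a) / 3] and [(s + x) / 3], for [x] the least point
   of [A] beyond [(s + a) / 3], together with [prof_double] cover almost all of
   [[2 s / 9 + a / 3, 2 s / 3]]; the rest is what makes the second alternative. *)
Lemma prof_dense s u : A s -> A u -> 2 * s / 3 <= u -> u <= s ->
  F u = F (2 * s / 3) -> s - u <= 2 * (F s - F u) ->
  F s <= s / 3 + F (2 * s / 9 + a / 3) \/
  exists2 x, a <= 3 * x < u - 2 * s / 3 & F s <= s / 3 - x + F ((u + a) / 3).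
Proof.
move=> As Au su us Fu Du.
have Fus := lip _ _ us; have [/(_ Du) tp _] := double u s Au As us.
have w1 := prof_window u s a us Aa _ _ erefl erefl.
have h1 := prof_lipP (2 * s / 9 + a / 3) ((u + a) / 3).
have [c|/ltW c] := leP (2 * u / 3) ((s + a) / 3).
  by left; have := mono _ _ c; case: h1 => [[? ?]|[? ? ?]]; lra.
have [[x [Ax sx xu Fx]]|Fe] := minP _ _ c; last first.
  by left; case: h1 => [[? ?]|[? ? ?]]; lra.
have w2 := prof_window u s x us Ax _ _ erefl erefl.
have h2 := prof_lipP x ((u + x) / 3).
have h3 := prof_lipP ((s + x) / 3) (2 * u / 3).
have [k|k] := leP (u - 2 * s / 3) (3 * x - s); [left|right; exists (x - s / 3)];
case: h1 => [[? ?]|[? ? ?]]; case: h2 => [[? ?]|[? ? ?]];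
case: h3 => [[? ?]|[? ? ?]]; lra.
Qed.

(** For [x] the least point of [A] in [[s / 3, 2 u / 3]], the window of [x] leaves at most the
    length [u - 2 s / 3] of [[x, 2 u / 3]] uncovered. *)
Lemma prof_mid s u : A s -> A u -> 2 * s / 3 <= u -> u <= s ->
  F (2 * u / 3) - F (s / 3) <= ((s - u) - (F s - F u)) / 3 + (u - 2 * s / 3).
Proof.
move=> As Au su us; have s0 := lb s As.
have c : s / 3 <= 2 * u / 3 by move: a0; lra.
have Fus := lip _ _ us.
have [[x [Ax sx xu Fx]]|Fe] := minP _ _ c; last by lra.
have w2 := prof_window u s x us Ax _ _ erefl erefl.
have h2 := prof_lipP x ((u + x) / 3).
have h3 := prof_lipP ((s + x) / 3) (2 * u / 3).
case: h2 => [[? ?]|[? ? ?]]; case: h3 => [[? ?]|[? ? ?]]; lra.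
Qed.

(* The slope and the constant are those which [F s <= s / 3 + F (2 s / 9 + a / 3)]
   turns into [77 / 177] at the top scale, where the terms in [a] cancel. *)
Lemma prof_linear y : a <= y -> y <= 27 / 4 * a -> F y <= (27 * y - 9 * a) / 59.
Proof.
have step s : A s -> s <= 27 / 4 * a ->
    (forall z, a <= z -> z <= 2 * s / 3 -> F z <= (27 * z - 9 * a) / 59) ->
    F s <= (27 * s - 9 * a) / 59.
  move=> As sa IH; have as_ := lb s As.
  have [s3|/ltW s3] := leP s (3 * a).
    have Fs3 : F s <= s / 3 by apply: prof_third => //; move: a0; lra.
    by have := prof_le s as_; lra.
  have [u [Au su us Fu]] := prof_top s As.
  have IHs := IH (2 * s / 3) ltac:(lra) (lexx _).
  (* The line rises by exactly [9 / 59 * s] on [[2 s / 3, s]], so the bound at [2 s / 3] settles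
     this case. *)
  have [tl|tl] := leP (F s - F u) (9 / 59 * s); first by lra.
  have Fus := lip _ _ us.
  have [Du|/ltW Du] := leP (s - u) (2 * (F s - F u)).
    case: (prof_dense s u As Au su us Fu Du) => [Fs|[x /andP[x3 x4] Fs]].
      have := prof_third (2 * s / 9 + a / 3) ltac:(lra) ltac:(lra).
      have := prof_le (2 * s / 9 + a / 3) ltac:(lra); lra.
    have := IH ((u + a) / 3) ltac:(lra) ltac:(lra); lra.
  (* With [t = F s - F u], [tp] and [md] add up to [F s <= (s - t) / 3 + F (s / 3)]. *)
  have [_ /(_ Du) tp] := double u s Au As us.
  have md := prof_mid s u As Au su us.
  have [b|/ltW b] := leP (2 * s / 3) (3 * a).
    have := prof_third (2 * s / 3) ltac:(lra) b; lra.
  have := prof_third (s / 3) ltac:(lra) ltac:(lra); lra.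
have ap : 0 < a by exact: a0.
(* Induction over steps of length [a / 3]: as [s >= a], passing to [2 s / 3] goes down by at least
   one. *)
have [n] : exists n : nat, y <= a + n%:R * (a / 3).
  have [|y0] := leP y 0; first by exists 0%N; rewrite mul0r; lra.
  exists (Num.bound (y / (a / 3))); apply: (@le_trans _ _ (y / (a / 3) * (a / 3))).
    by rewrite divfK //; lra.
  rewrite -[X in X <= _]add0r lerD ?ltW // ltr_pM2r ?archi_boundP //; last lra.
  by rewrite divr_ge0; lra.
elim: n y => [|n IH] y.
  rewrite mul0r addr0 => ya ay _; have ->: y = a by lra.
  by rewrite F0 //; lra.
rewrite -natr1 mulrDl mul1r => yn ay yb.
have [[s [As as_ sy <-]]|<-] := maxP a y ay; last first.
  by rewrite F0 //; lra.
suff : F s <= (27 * s - 9 * a) / 59 by lra.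
apply: step => // [|z az zs]; first lra.
by apply: IH => //; lra.
Qed.

(* [s] nearly maximizes [F s / s]: at smaller scales [F] exceeds the line of
   slope [77 / 177] by less than at [s]. *)
Lemma prof_extremal s e : A s -> 0 < e -> F s = 77 / 177 * s + e ->
  (forall x, 0 <= x -> x <= 2 * s / 3 -> F x <= 77 / 177 * x + 8 / 9 * e) -> False.
Proof.
move=> As e0 Fs ub; have ap : 0 < a by exact: a0.
have as_ := lb s As.
(* At [27 / 4 * a] the line of [prof_linear] meets the line [77 / 177 * y]; before that it lies
   below. *)
have [sa|/ltW sa] := leP s (27 / 4 * a).
  by have := prof_linear s as_ sa; lra.
have [u [Au su us Fu]] := prof_top s As.
have ub2 := ub (2 * s / 3) ltac:(lra) (lexx _).
have ub1 := ub (s / 3) ltac:(lra) ltac:(lra).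
have Fus := lip _ _ us.
have [Du|/ltW Du] := leP (s - u) (2 * (F s - F u)); last first.
  (* As in [prof_linear], [F s <= (s - t) / 3 + F (s / 3)]; averaging with [F s = t + F (2 s / 3)]
     in the ratio 3 to 1 removes [t]. *)
  have [_ /(_ Du) tp] := double u s Au As us.
  by have md := prof_mid s u As Au su us; lra.
have [/(_ Du) tp _] := double u s Au As us.
case: (prof_dense s u As Au su us Fu Du) => [Fs1|[x /andP[x3 x4] Fs1]].
  have [ya|ya] := leP (2 * s / 9 + a / 3) (27 / 4 * a).
    by have := prof_linear _ _ ya; lra.
  by have := ub (2 * s / 9 + a / 3) ltac:(lra) ltac:(lra); lra.
have auy : a <= (u + a) / 3 by lra.
(* [Fs1] makes [F c = F ((u + a) / 3)] large, and [ub] at [c] then forces [c] itself to be large. *)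
have [[c [Ac ac cu Fc]]|Fe] := maxP _ _ auy; last first.
  by have := F0 a (lexx _); lra.
have ubc := ub c ltac:(lra) ltac:(lra).
have wa := prof_window u s a us Aa _ _ erefl erefl.
(* The first argument below works up to about [73 / 1000 * s], the second one
   from about [65 / 1000 * s] on. In the first, the window of [c] contains
   [[s / 3, (s + c) / 3]], and [reflect] at [v] bounds the rest of [A] below
   [2 * u / 3]; [F (s / 3)] is at most [77 / 177 * (s / 3)] up to [e], and also
   at most [F c] plus the window of [a]. *)
have [kap|kap] := leP (u - 2 * s / 3) (7 / 100 * s).
  have wc := prof_window u s c us Ac _ _ erefl erefl.
  have m1 := mono ((u + c) / 3) (s / 3) ltac:(lra).
  have m2 := mono (s / 3) ((s + a) / 3) ltac:(lra).
  have cu2 : (s + c) / 3 <= 2 * u / 3 by lra.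
  have m3 := mono ((u + c) / 3) ((s + a) / 3) ltac:(lra).
  have [[v [Av cv vu Fv]]|Fe] := minP _ _ cu2; last by lra.
  have rf := reflect u s v Av ltac:(lra) ltac:(lra).
  have m4 := mono (2 * u / 3) (3 * v - u) ltac:(lra).
  have h1 := prof_lipP ((s + v) / 3) (2 * u / 3).
  by case: h1 => [[? ?]|[? ? ?]]; lra.
have s2u : s / 3 <= 2 * u / 3 by lra.
have [[v [Av sv vu Fv]]|Fe] := minP _ _ s2u; last by lra.
have wv := prof_window u s v us Av _ _ erefl erefl.
have h1 := prof_lipP v ((u + v) / 3).
have s32 : s / 3 <= s / 2 by lra.
have h2 := prof_lipP (s / 2) (2 * u / 3).
(* Up to [s / 2] a point [w] is at most [(s + w) / 3], so the window of [w] reaches beyond all of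
   [A] below [s / 2], up to measure zero. What lies in [[s / 2, 2 u / 3]] is bounded by length. *)
have [[w [Aw sw wu Fw]]|Fe] := maxP _ _ s32; last first.
  by case: h1 => [[? ?]|[? ? ?]]; case: h2 => [[? ?]|[? ? ?]]; lra.
have ww := prof_window u s w us Aw _ _ erefl erefl.
have m5 := mono w ((s + w) / 3) ltac:(lra).
have h3 := prof_lipP ((s + v) / 3) ((u + w) / 3).
by case: h1 => [[? ?]|[? ? ?]]; case: h2 => [[? ?]|[? ? ?]];
   case: h3 => [[? ?]|[? ? ?]]; lra.
Qed.

Lemma prof_bound y : 0 <= y -> F y <= 77 / 177 * y.
Proof.
move=> y0; have ap : 0 < a by exact: a0.
rewrite leNgt; apply/negP => Fy.
have ay : a <= y.
  by rewrite leNgt; apply/negP => /ltW ya; move: Fy; rewrite F0 //; lra.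
pose S := [set F x / x | x in [set x | a <= x]].
have Sy : S (F y / y) by exists y.
have hS : has_sup S.
  split; first by exists (F y / y).
  exists 1 => _ [x /= ax <-]; have := prof_le x ax.
  by rewrite ler_pdivrMr; lra.
pose r := sup S; have rub x : a <= x -> F x <= r * x.
  move=> ax; rewrite -ler_pdivrMr; last lra.
  by apply: sup_upper_bound => //; exists x.
have rM : 77 / 177 < r.
  have := rub y ay => Fr; rewrite -(@ltr_pM2r _ y); lra.
(* With [d = r - 77 / 177], the slack [d / 4] leaves an excess of at least [3 / 4 * d * s] at [s];
   for [z <= 2 s / 3] the excess is at most [2 / 3 * d * s], which is [8 / 9] of that. *)
have e0 : 0 < (r - 77 / 177) / 4 by lra.
have [_ [x /= ax <-] Fx] := sup_adherent e0 hS.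
have xp : 0 < x by lra.
move: Fx; rewrite -/r ltr_pdivlMr // => Fx.
(* Moving down to the last point of [A] keeps [F] and can only raise the quotient. *)
have [[s [As as_ sx Fs]]|Fe] := maxP a x ax; last first.
  have := mulr_gt0 ap xp; move: Fx; rewrite -Fe F0 //.
  have : 0 < (r - (r - 77 / 177) / 4) * x by rewrite mulr_gt0 //; lra.
  lra.
have d0 : 0 <= r - (r - 77 / 177) / 4 by lra.
have Fss := ler_wpM2l d0 sx.
have d1 : 0 < r - 77 / 177 by lra.
have sp : 0 < s by lra.
have ds : 0 < (r - 77 / 177) * s by exact: mulr_gt0.
apply: (prof_extremal s (F s - 77 / 177 * s) As).
- by rewrite Fs; lra.
- lra.
move=> z z0 zs; have dz := ler_wpM2l (ltW d1) zs.
have Fz : F z <= r * z.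
  have [za|/ltW az] := leP z a; last exact: rub.
  by rewrite F0 // mulr_ge0 //; lra.
by rewrite Fs; lra.
Qed.
End Arith.

(** * From profiles to compact and measurable sets *)

Lemma compact_profile (R : realType) (A : set R) :
  compact A -> three_sum_free A -> A !=set0 -> (forall x, A x -> 0 <= x) ->
  exists a, profile R A a (cdf R A).
Proof.
move=> cA sA A0 Age0.
have mA : measurable A by exact: measurable_realfun.compact_measurable.
have Afin : (lebesgue_measure A < +oo)%E by exact: compact_finite_measure.
have idc : {within A, continuous (@idfun R)}.
  by apply: continuous_subspaceT => x; exact: cvg_id.
have [a] := compact_EVT_min A0 cA idc; rewrite inE => Aa amin.
have lb x : A x -> a <= x by move=> Ax; apply: amin; rewrite inE.
exists a; split => //.
(* The point 0 is excluded by [0 + 0 = 3 * 0]. *)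
- rewrite lt_neqAle Age0 // andbT; apply/eqP => a0.
  by have := sA _ _ _ Aa Aa Aa; rewrite -a0 addr0 mulr0 eqxx.
- move=> x xa; apply/eqP; rewrite -eqe -cdfE // eq_le measure_ge0 andbT.
  rewrite -[X in (_ <= X)%E](lebesgue_measure_set1 a) le_measure ?inE //.
    by apply: measurableI.
  move=> z [/lb az] /=; rewrite in_itv /= => zx.
  by apply/eqP; rewrite eq_le az (le_trans zx).
- exact: cdf_mono.
- exact: cdf_lip.
- exact: cdf_min.
- exact: cdf_max.
- exact: cdf_shift.
- exact: cdf_reflect.
- exact: cdf_double.
Qed.

Lemma compact_three_sum_free_le (R : realType) (A : set R) :
  compact A -> A `<=` `[0, 1] -> three_sum_free A ->
  (lebesgue_measure A <= (77 / 177 : R)%:E)%E.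
Proof.
move=> cA A01 sA.
have [->|/set0P A0] := eqVneq A set0; first by rewrite measure0 lee_fin; lra.
have mA : measurable A by exact: measurable_realfun.compact_measurable.
have Afin : (lebesgue_measure A < +oo)%E by exact: compact_finite_measure.
have Age0 x : A x -> 0 <= x by move/A01; rewrite /= in_itv => /andP[].
have [a P] := compact_profile R A cA sA A0 Age0.
have -> : lebesgue_measure A = (cdf R A 1)%:E.
  rewrite -cdfE //; congr lebesgue_measure; apply/seteqP; split => [z Az|z []//].
  by split => //; move/A01: Az; rewrite /= !in_itv /= => /andP[].
by rewrite lee_fin -[X in _ <= X]mulr1; apply: prof_bound P _ _.
Qed.

Lemma measurable_three_sum_free_le (R : realType) (A : set R) :
  measurable A -> A `<=` `[0, 1] -> three_sum_free A ->
  (lebesgue_measure A <= (77 / 177 : R)%:E)%E.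
Proof.
move=> mA A01 sA; apply/lee_addgt0Pr => e e0.
have Afin : (lebesgue_measure A < +oo)%E.
  apply: (@le_lt_trans _ _ (lebesgue_measure `[0 : R, 1])).
    by rewrite le_measure ?inE.
  by rewrite lebesgue_measure_itv /= lte01 -EFinB ltry.
have [V [cV VA Ve]] := lebesgue_regularity_inner mA Afin e0.
have mV : measurable V by exact: measurable_realfun.compact_measurable.
have -> : (lebesgue_measure A = lebesgue_measure (A `\` V) + lebesgue_measure V)%E.
  by rewrite -[X in (_ + lebesgue_measure X)%E](setIidr VA); exact: measureDI.
rewrite addeC leeD ?(ltW Ve) //.
by apply: compact_three_sum_free_le => // [x /VA/A01|x y z /VA Ax /VA Ay /VA Az]; [|exact: sA].
Qed.

Theorem theorem1p1 (R : realType) (A : set R) :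
  lebesgue_measurable A ->
  A `<=` `[0%R, 1%R] ->
  three_sum_free A ->
  (@completed_lebesgue_measure R A <= ((77%:R / 177%:R : R)%:E))%E.
Proof.
move=> mA A01 sA; move: mA; rewrite /lebesgue_measurable.
have -> : measurable (A : set (caratheodory_type (@wlength R idfun)^*%mu)) =
   (completed_algebra_gen (@lebesgue_measure R)).-sigma.-measurable A.
  by rewrite completed_caratheodory_measurable.
(* [A] is a Borel set [X] together with a null set [N], and [X] inherits sum-freeness from [A]. *)
rewrite g_sigma_completed_algebra_genE => -[X mX [N /negligible_outer_measure N0] XN].
have XA : X `<=` A by rewrite -XN => x; left.
apply: (@le_trans _ _ (lebesgue_measure X)); last first.
  apply: measurable_three_sum_free_le => // [x /XA/A01|x y z /XA Ax /XA Ay /XA Az] //.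
  exact: sA.
rewrite -XN; apply: (@le_trans _ _ ((wlength idfun)^* X + (wlength idfun)^* N)%mu%E).
  exact: outer_measureU2.
by rewrite N0 adde0.
Qed.
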